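(* Let $a,b$ be positive integers, let $\{F_n(q)\}_{n\geq 0}$ be the $q$-biperiodic Fibonacci sequence and, for $s\geq 0$, let $\{F^{(s)}_n(q)\}_{n\geq 0}$ be the shifted $q$-biperiodic Fibonacci sequence. For every integer $n\geq 0$, $$F_{2n}(q)=\sum_{k=1}^n a^{\xi(k)}q^{(n-k)^2} {n\brack k}(ab)^{\left\lfloor \frac k2 \right\rfloor} F_{k}^{(2n-k)}(q).$$
   Context: Fix positive integers $a,b$; $q$ is an indeterminate. For an integer $n$, $\xi(n)=n-2\lfloor n/2\rfloor$ (so $\xi(n)=0$ if $n$ is even and $1$ if $n$ is odd). The $q$-biperiodic Fibonacci sequence is defined by $F_0(q)=0$, $F_1(q)=1$ and, for $n\geq 2$, $F_n(q)=aF_{n-1}(q)+q^{n-2}F_{n-2}(q)$ if $n$ is even, $F_n(q)=bF_{n-1}(q)+q^{n-2}F_{n-2}(q)$ if $n$ is odd. For an integer $s\geq 0$, the shifted $q$-biperiodic Fibonacci sequence is defined by $F^{(s)}_0(q)=0$, $F^{(s)}_1(q)=1$ and, for $n\geq 2$, $$F^{(s)}_{n}(q)=\begin{cases} a^{\xi(s+1)}b^{1-\xi(s+1)}F^{(s)}_{n-1}(q) + q^{n-2+s}F^{(s)}_{n-2}(q), & n \text{ even},\\ a^{1-\xi(s+1)}b^{\xi(s+1)}F^{(s)}_{n-1}(q) + q^{n-2+s}F^{(s)}_{n-2}(q), & n\text{ odd}.\end{cases}$$ The $q$-binomial coefficient is ${n\brack k}=\frac{[n]_q!}{[k]_q!\,[n-k]_q!}$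 for $0\leq k\leq n$, where $[n]_q=1+q+\cdots+q^{n-1}$ and $[n]_q!=[1]_q[2]_q\cdots[n]_q$, $[0]_q!=1$. Empty sums are $0$. *)

(* Defs.v *)
(* The indeterminate q is the variable 'X of {poly int}. *)
From mathcomp Require Import all_boot all_order all_algebra.
Set Implicit Arguments.
Unset Strict Implicit.
Unset Printing Implicit Defensive.

Import GRing.Theory.
Local Open Scope ring_scope.

Notation "x %:F" := (FracField.tofrac x) : ring_scope.

(* Only nonnegative arguments occur, so nat stands for the integers. *)
Definition xi (n : nat) : nat := (n - 2 * (n %/ 2))%N.

(* In both recursions the index is m = n2.+2, so q^(m-2) is 'X^n2 and
   q^(m-2+s) is 'X^(n2 + s). *)
Fixpoint qbiFib (a b n : nat) : {poly int} :=
  match n with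
  | 0 => 0
  | 1 => 1
  | (n2.+1 as n1).+1 =>
      (if odd n then b else a)%:R * qbiFib a b n1 + 'X^n2 * qbiFib a b n2
  end.

Fixpoint shifted_qbiFib (a b s n : nat) : {poly int} :=
  match n with
  | 0 => 0
  | 1 => 1
  | (n2.+1 as n1).+1 =>
      (if odd n then a%:R ^+ (1 - xi s.+1) * b%:R ^+ xi s.+1
       else a%:R ^+ xi s.+1 * b%:R ^+ (1 - xi s.+1))
      * shifted_qbiFib a b s n1
      + 'X^(n2 + s) * shifted_qbiFib a b s n2
  end.

Definition qint (n : nat) : {poly int} := \sum_(i < n) 'X^i.

Definition qfact (n : nat) : {poly int} := \prod_(1 <= i < n.+1) qint i.

(* The quotient is taken in the field of fractions of Z[q]; it is meaningful
   for k <= n only, since n - k is truncated. *)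
Definition qbinom (n k : nat) : {fraction {poly int}} :=
  (qfact n)%:F / ((qfact k)%:F * (qfact (n - k))%:F).

(* Main.v *)
(* Write F^(s)_m for the shifted sequence.  Its recursion peels off the last
   step of a path; peeling off the first step instead gives
   F^(s)_(m+2) = c_s F^(s+1)_(m+1) + q^(s+1) F^(s+2)_m, with c_s = a or b
   according to the parity of s.  Along the sequence m |-> F^(M-m)_m this is a
   two-term rule whose two moves q-commute, so iterating it n times yields a
   q-binomial expansion, by induction on n with the q-Pascal rule.  The theorem
   is the case s = 0 with the lower index starting at 0. *)
Require Import Defs.
From mathcomp Require Import all_boot all_order all_algebra.
From mathcomp Require Import ring zify.
Set Implicit Arguments.
Unset Strict Implicit.
Unset Printing Implicit Defensive.
Import GRing.Theory.
Local Open Scope ring_scope.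

(** The [q]-binomial built by the [q]-Pascal rule: no division, so the expansion can be proved
    inside [{poly int}]. *)
Fixpoint gauss_binom (n k : nat) : {poly int} :=
  match n, k with
  | _, 0 => 1
  | 0, _.+1 => 0
  | n'.+1, k'.+1 => gauss_binom n' k' + 'X^k * gauss_binom n' k
  end.

Lemma gauss_binom0 n : gauss_binom n 0 = 1.
Proof. by case: n. Qed.

Lemma gauss_binomS n k :
  gauss_binom n.+1 k.+1 = gauss_binom n k + 'X^(k.+1) * gauss_binom n k.+1.
Proof. by []. Qed.

Lemma gauss_binom_small n k : (n < k)%N -> gauss_binom n k = 0.
Proof.
elim: n k => [|n IHn] [|k] //; rewrite ltnS => lt_nk.
by rewrite gauss_binomS !IHn ?mulr0 ?addr0 // ltnW.
Qed.

Lemma qintD m n : qint (m + n) = qint m + 'X^m * qint n.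
Proof.
rewrite /qint big_split_ord mulr_sumr /=; congr (_ + _).
by apply: eq_bigr => i _; rewrite exprD.
Qed.

Lemma qint_neq0 n : (0 < n)%N -> qint n != 0.
Proof.
(* At [q = 0] only the constant term 1 survives. *)
case: n => // n _; apply/eqP => /(congr1 (horner^~ 0)).
rewrite /qint horner_sum horner0 big_ord_recl expr0 hornerC big1 ?addr0 //.
by move=> i _; rewrite hornerXn expr0n.
Qed.

Lemma qfact0 : qfact 0 = 1.
Proof. by rewrite /qfact big_geq. Qed.

Lemma qfactS n : qfact n.+1 = qfact n * qint n.+1.
Proof. by rewrite /qfact big_nat_recr. Qed.

Lemma qfact_neq0 n : qfact n != 0.
Proof.
elim: n => [|n IHn]; first by rewrite qfact0 oner_neq0.
by rewrite qfactS mulf_neq0 ?qint_neq0.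
Qed.

(** Both terms of the [q]-Pascal rule lower [i + j] by one, and their factors recombine through
    [[i+1] + q^(i+1) [j+1] = [i+j+2]]. *)
Lemma gauss_binom_fact i j :
  gauss_binom (i + j) i * (qfact i * qfact j) = qfact (i + j).
Proof.
have [n] := ubnP (i + j); elim: n i j => // n IHn [|i] [|j] lt_n.
- by rewrite gauss_binom0 qfact0 !mul1r.
- by rewrite gauss_binom0 qfact0 !mul1r.
- rewrite addn0 gauss_binomS (@gauss_binom_small i i.+1) // mulr0 addr0.
  rewrite qfact0 mulr1 qfactS mulrA.
  have /= := IHn i 0%N; rewrite addn0 qfact0 mulr1 => -> //.
  by move: lt_n; rewrite addn0.
have IH1 : gauss_binom (i + j.+1) i * (qfact i * qfact j.+1) = qfact (i + j.+1).
  by apply: IHn; rewrite -ltnS.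
have IH2 : gauss_binom (i + j.+1) i.+1 * (qfact i.+1 * qfact j)
    = qfact (i + j.+1).
  by rewrite -addSnnS; apply: IHn; rewrite addSnnS -ltnS.
rewrite addSn gauss_binomS [RHS]qfactS -addSn qintD mulrDr -{1}IH1 -IH2.
by rewrite !qfactS; ring.
Qed.

Lemma qbinomE n k : (k <= n)%N -> qbinom n k = (gauss_binom n k)%:F.
Proof.
move=> le_kn; rewrite /qbinom -rmorphM /=.
apply: canLR (mulfK _) _.
  by rewrite tofrac_eq0 mulf_neq0 ?qfact_neq0.
by rewrite -rmorphM /= -{2 3}(subnKC le_kn) addKn gauss_binom_fact subnKC.
Qed.

Section Shifted.
Variables a b : nat.

Let c (i : nat) : {poly int} := (if odd i then b else a)%:R.
Let F := shifted_qbiFib a b.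

Lemma xiE n : xi n = odd n.
Proof. by rewrite /xi; lia. Qed.

Lemma c_addn2 i : c i.+2 = c i.
Proof. by rewrite /c /= negbK. Qed.

Lemma shifted_qbiFibSS s m : F s m.+2 = c (m + s) * F s m.+1 + 'X^(m + s) * F s m.
Proof.
rewrite /F /= !xiE /c oddD /= negbK.
by case: (odd m); case: (odd s); rewrite /= ?expr0 ?expr1 ?mul1r ?mulr1.
Qed.

Lemma qbiFib_shifted0 n : qbiFib a b n = F 0 n.
Proof.
suff [] : qbiFib a b n = F 0 n /\ qbiFib a b n.+1 = F 0 n.+1 by [].
elim: n => [//|n [IHn IHn1]]; split=> //.
by rewrite shifted_qbiFibSS -IHn -IHn1 addn0 /c /= negbK.
Qed.

(** The last-step coefficients depend only on index plus shift, which agrees for the three terms.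
    Both sides thus obey the same linear recursion in [m], and two initial values suffice. *)
Lemma shifted_qbiFib_peel_first s m :
  F s m.+2 = c s * F s.+1 m.+1 + 'X^(s.+1) * F s.+2 m.
Proof.
suff [] : F s m.+2 = c s * F s.+1 m.+1 + 'X^(s.+1) * F s.+2 m /\
  F s m.+3 = c s * F s.+1 m.+2 + 'X^(s.+1) * F s.+2 m.+1 by [].
elim: m => [|m [IHm IHm1]]; split=> //.
- by rewrite shifted_qbiFibSS /F /= !mulr0.
- rewrite !shifted_qbiFibSS /F /= !add0n add1n; ring.
rewrite (shifted_qbiFibSS s m.+2) IHm IHm1 (shifted_qbiFibSS s.+1 m.+1).
rewrite (shifted_qbiFibSS s.+2 m) -!addSnnS c_addn2; ring.
Qed.

(** Here [k] counts the moves with coefficient [c]. The offset [j] stays general because the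
    induction uses [j + 2(n+1) = (j+2) + 2n]. *)
Lemma shifted_qbiFib_expand n s j :
  F s (j + n.*2) = \sum_(k < n.+1) gauss_binom n k * 'X^((n - k) * (n - k + s))
    * (\prod_(i < k) c (s + i)) * F (s + n.*2 - k) (j + k).
Proof.
elim: n j => [|n IHn] j.
  by rewrite big_ord1 big_ord0 !mulr1 !addn0 subn0 mul1r.
pose t k := gauss_binom n k * 'X^((n - k) * (n - k + s))
    * \prod_(i < k) c (s + i).
have step (k : 'I_n.+1) : t k * F (s + n.*2 - k) (j.+2 + k)
  = gauss_binom n k * 'X^((n - k) * (n - k + s))
      * (\prod_(i < k.+1) c (s + i)) * F (s + n.+1.*2 - k.+1) (j + k.+1)
  + 'X^k * gauss_binom n k * 'X^((n.+1 - k) * (n.+1 - k + s))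
      * (\prod_(i < k) c (s + i)) * F (s + n.+1.*2 - k) (j + k).
  have le_kn : (k <= n)%N by rewrite -ltnS.
  (* By parity, the peeled coefficient is the next factor of the product. *)
  have Ec : c (s + n.*2 - k) = c (s + k).
    by rewrite /c; congr ((if _ then _ else _)%:R); lia.
  rewrite !addSn shifted_qbiFib_peel_first Ec big_ord_recr /= /t.
  have -> : (s + n.+1.*2 - k.+1 = (s + n.*2 - k).+1)%N by lia.
  have -> : (s + n.+1.*2 - k = (s + n.*2 - k).+2)%N by lia.
  (* Completing the exponent to that of [n+1] leaves [q^k], the weight in the [q]-Pascal rule. *)
  have EX : 'X^((n - k) * (n - k + s)) * 'X^((s + n.*2 - k).+1)
      = 'X^k * 'X^((n.+1 - k) * (n.+1 - k + s)) :> {poly int}.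
    rewrite -!exprD; congr ('X^ _); rewrite subSn //.
    have -> : (s + n.*2 - k = k + (n - k).*2 + s)%N by lia.
    by move: (n - k)%N => u; nia.
  rewrite addnS mulrDr; congr (_ + _); first by ring.
  transitivity (gauss_binom n k * \prod_(i < k) c (s + i) * F (s + n.*2 - k).+2 (j + k)
    * ('X^((n - k) * (n - k + s)) * 'X^((s + n.*2 - k).+1))); first by ring.
  by rewrite EX; ring.
have -> : (j + n.+1.*2 = j.+2 + n.*2)%N by lia.
rewrite IHn (eq_bigr _ (fun k _ => step k)) big_split /=.
rewrite [RHS]big_ord_recl [X in _ + X]big_ord_recl /= addrCA gauss_binom0.
rewrite expr0 !mul1r; congr (_ + _).
under [RHS]eq_bigr do rewrite add0n !mulrDl.
rewrite big_split /=; congr (_ + _).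
(* The surplus top term contains [gauss_binom n n.+1 = 0]. *)
rewrite [RHS]big_ord_recr /= gauss_binom_small // mulr0 !mul0r addr0.
by apply: eq_bigr => k _.
Qed.

Lemma prod_alternating k : \prod_(i < k) c i = a%:R ^+ xi k * (a * b)%:R ^+ (k %/ 2).
Proof.
elim: k => [|k IHk]; first by rewrite big_ord0 !mulr1.
rewrite big_ord_recr /= IHk !xiE !divn2 /c /= uphalf_half natrM.
by case: (odd k); rewrite /= ?add0n ?add1n ?exprS ?expr0; ring.
Qed.

End Shifted.

Theorem theorem16 (a b : nat) (ha : (0 < a)%N) (hb : (0 < b)%N) (n : nat) :
  (qbiFib a b (2 * n))%:F =
  \sum_(1 <= k < n.+1)
     (a%:R ^+ xi k * 'X^((n - k) ^ 2))%:F * qbinom n k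
     * ((a * b)%:R ^+ (k %/ 2) * shifted_qbiFib a b (2 * n - k) k)%:F
  :> {fraction {poly int}}.
Proof.
rewrite qbiFib_shifted0 mul2n -[n.*2]add0n shifted_qbiFib_expand.
(* The term [k = 0] drops out, as its Fibonacci factor has index 0. *)
rewrite big_ord_recl /= mulr0 add0r rmorph_sum /= big_add1 /= big_mkord.
apply: eq_bigr => k _; rewrite /bump /= !add0n add1n qbinomE ?ltn_ord //.
rewrite -!rmorphM /= prod_alternating addn0 -mulnn; congr (_ %:F); ring.
Qed.
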